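(* Let $G$ be a finite group of order $n>1$ generated by $\Delta$, and suppose $\Delta\subseteq\Sigma\subseteq T_G$ with $(G,\Sigma)$ a synchronizing automaton. Then $(G,\Sigma)$ admits a synchronizing word of length at most \[1+\left(n-m(G)+\mathrm{diam}_{\Delta}(G)\right)(n-2).\] In particular, if $\mathrm{diam}_{\Delta}(G)\leq m(G)$, then $(G,\Sigma)$ admits a synchronizing word of length at most $(n-1)^2$, and hence $(G,\Delta)$ is a Černý Cayley graph.
   Context: For a finite set $X$, $T_X$ is the set of all maps $X\to X$, acting on the right of $X$. An automaton with state set $X$ is a subset $\Sigma\subseteq T_X$, written $(X,\Sigma)$. The free monoid $\Sigma^*$ acts on the right of $X$ via the homomorphism $\Sigma^*\to T_X$ extending the inclusion $\Sigma\hookrightarrow T_X$. A word $w\in\Sigma^*$ is synchronizing if $|Xw|=1$; the automaton is synchronizing if it admits a synchronizing word. If $G$ is a finite group with generating set $\Delta$, elements of $\Delta$ are identified with the right translations $g\mapsto gd$ of $G$, so $\Delta\subseteq T_G$; the automaton $(G,\Delta)$ is the Cayley graph of $G$ with respect to $\Delta$. With $n=|G|$, $(G,\Delta)$ is a Černý Cayley graph if every synchronizing automaton $(G,\Sigma)$ with $\Delta\subseteq\Sigma\subseteq T_G$ admits a synchronizing word of length at most $(n-1)^2$. The diameter $\mathrm{diam}_\Delta(G)$ is the least positive integer $m$ such that each element of $G$ can be represented by a word in $\Delta^*$ of length at most $m$. Finally, $m(G)$ is the maximum degree (dimension) of an irreducible representation of $G$ over $\mathbb{Q}$. *)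

(* Defs.v *)
From mathcomp Require Import all_boot all_fingroup all_algebra.
From mathcomp Require Import all_character.
From mathcomp Require Import boolp.

Set Implicit Arguments.
Unset Strict Implicit.
Unset Printing Implicit Defensive.

Import GroupScope GRing.Theory.

Section Automata.

Variable X : finType.

Definition transf := {ffun X -> X}.

Implicit Types (Sigma : {set transf}) (w : seq transf).

(* Letters are applied from left to right: maps act on the right of X. *)
Definition run (x : X) w : X := foldl (fun y (f : transf) => f y) x w.

Definition word_over (T : finType) (A : {set T}) (w : seq T) : Prop :=
  {subset w <= A}.

Definition sync_word Sigma w : Prop :=
  word_over Sigma w /\ #|[set run x w | x : X]| = 1%N.

Definition synchronizing Sigma : Prop := exists w, sync_word Sigma w.

Definition has_sync_word_leq Sigma (l : nat) : Prop :=
  exists2 w, sync_word Sigma w & (size w <= l)%N.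

End Automata.

Section Cayley.

Variable gT : finGroupType.

Implicit Type Delta : {set gT}.

(* {set transf gT} carries the automata whose states are the elements of gT;
   a subset Delta of the group enters through its right translations. *)
Definition right_transl (d : gT) : transf gT := [ffun g => g * d].

Definition cayley Delta : {set transf gT} := right_transl @: Delta.

Definition cerny_cayley Delta : Prop :=
  forall Sigma : {set transf gT},
    cayley Delta \subset Sigma -> synchronizing Sigma ->
    has_sync_word_leq Sigma ((#|gT| - 1) ^ 2)%N.

Definition covers Delta (m : nat) : Prop :=
  forall g : gT, exists w : seq gT,
    [/\ word_over Delta w, (size w <= m)%N & \prod_(d <- w) d = g].

Lemma covers_exists Delta : <<Delta>> = [set: gT] ->
  exists m, (0 < m)%N && asbool (covers Delta m).
Proof.
move=> genD.
have word g : exists w : seq gT, word_over Delta w /\ \prod_(d <- w) d = g.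
  have /gen_prodgP[k [c Dc ->]] : g \in <<Delta>> by rewrite genD inE.
  exists [seq c i | i <- enum 'I_k]; split.
    by move=> _ /mapP[i _ ->].
  by rewrite big_map /= [index_enum _]unlock enumT.
have [f fP] := choice word.
exists (\max_g size (f g)).+1; apply/andP; split=> //; apply/asboolP => g.
exists (f g); have [Df pf] := fP g; split=> //.
by apply: leqW; apply: (leq_bigmax (F := fun g => size (f g))).
Qed.

Definition diam Delta (genD : <<Delta>> = [set: gT]) : nat :=
  ex_minn (covers_exists genD).

End Cayley.

Section IrreducibleDegrees.

Variables (gT : finGroupType) (G : {group gT}).

Definition irr_degree (d : nat) : Prop :=
  exists rG : mx_representation rat G d, mx_irreducible rG.

Lemma irr_degree_exists : exists d, asbool (irr_degree d).
Proof.
have triv : mx_repr G (fun _ : gT => 1%:M%R : 'M[rat]_1).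
  by split=> // x y _ _; rewrite mulmx1.
exists 1%N; apply/asboolP; exists (MxRepresentation triv).
apply/mx_irrP; split=> // U _ nzU.
by rewrite /row_full eqn_leq rank_leq_col lt0n mxrank_eq0.
Qed.

(* An irreducible module is cyclic, hence spanned by #|G| vectors. *)
Lemma irr_degree_leq d : asbool (irr_degree d) -> (d <= #|G|)%N.
Proof.
move/asboolP=> [rG irrG]; have [d_gt0 _] := (iffLR (mx_irrP rG)) irrG.
pose u : 'rV[rat]_d := delta_mx ord0 (Ordinal d_gt0).
have nzu : u != 0%R.
  apply/eqP => /matrixP/(_ ord0 (Ordinal d_gt0))/eqP.
  by rewrite !mxE !eqxx oner_eq0.
have eq1 := mxsimple_cyclic irrG nzu (submx1 u).
rewrite -(mxrank1 rat d) eq1 genmxE.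
by apply: leq_trans (mxrankM_maxl _ _) _; apply: rank_leq_row.
Qed.

Definition max_irr_degree : nat := ex_maxn irr_degree_exists irr_degree_leq.

End IrreducibleDegrees.

(* Main.v *)
Require Import Defs.
From HB Require Import structures.
From mathcomp Require Import all_boot all_order all_fingroup all_algebra.
From mathcomp Require Import all_character.
From mathcomp Require Import boolp zify.

(** The theorem reduces to an extension property: with n = #|G|, m = m(G) and
    D the diameter, every S with 0 < #|S| < n has a word v of length at most
    n - m + D such that #|S v^-1| > #|S|.  Indeed a synchronizing automaton
    with n > 1 has a non-injective letter; one of its fibres has at least two
    elements, and at most n - 2 extensions enlarge that fibre to all of G
    ([sync_word_of_extension]).

    For the extension property, let words act on the space Q^G of functions
    by (w f)(x) = f(x w), and let total f be the sum of the values of f.  With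
    f = 1_S - #|S|/n one has total (w f) = #|S w^-1| - #|S| and total f = 0,
    so a word v with total (v f) > 0 is wanted.  A word with
    total (v f) <> 0 might decrease the set instead; the sign is obtained by
    averaging over G.  If total f' = 0, then the numbers total (w g f'), for g
    in G, sum to zero; hence if one of them is nonzero, another one is
    positive, and the group element g costs a word of length at most D
    ([averaged_word]).

    The length is bounded by dimension counts ([positive_word]).  Let V be an
    irreducible module of dimension m.  There is a surjective G-morphism
    phi : Q^G -> V, so the kernel of phi has dimension n - m.  Let F_j be the
    span of the functions w f for words w of length at most j, with F_(-1) = 0;
    dim F_j grows
    strictly until F_j is stable under all letters.  As a synchronizing word
    makes f constant, and nonzero after a suitable translation, F_j eventually
    leaves the kernel of total.  Let j be the first index for which F_j is not
    contained in ker phi :&: ker total.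

    If F_j is not contained in ker total, then j <= dim F_(j-1) <= n - m, and
    averaging w g over g, for a word w of length at most j with
    total (w f) <> 0, gives a word of length at most n - m + D.

    Otherwise F_j is contained in ker total but phi is nonzero on it.  Let M
    be the G-submodule generated by F_j.  By irreducibility phi maps M onto V,
    and F_(j-1) lies in M :&: ker phi, so dim M >= j + m
    ([dim_orbit_span_gt]).  Starting from M, which lies in the
    (n - 1)-dimensional kernel of total, the same growth argument leaves that
    kernel after at most n - dim M <= n - m - j letters.  This gives words w1
    and w2 of lengths at most n - m - j and j, and h in G, with
    total (w1 h w2 f) <> 0; averaging over the middle factor costs D letters,
    for a total of n - m + D. *)

Set Implicit Arguments.
Unset Strict Implicit.
Unset Printing Implicit Defensive.

Import Order.TTheory GRing.Theory Num.Theory.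

(** * Growth of subspaces under a set of operators *)

Section SubspaceChains.

Local Open Scope ring_scope.

Variables (F : fieldType) (vT : vectType F) (A : finType) (op : A -> 'End(vT)).
Variable P : {set A}.
Implicit Types (U K : {vspace vT}) (i k l : nat).

Definition grow U : {vspace vT} := (U + \sum_(a in P) op a @: U)%VS.

Lemma sub_grow U : (U <= grow U)%VS.
Proof. exact: addvSl. Qed.

Lemma iter_grow_mono U i j : (i <= j)%N -> (iter i grow U <= iter j grow U)%VS.
Proof.
move=> /subnK <-; elim: (j - i)%N => //= k IHk.
exact: subv_trans IHk (sub_grow _).
Qed.

Lemma img_sub_grow a U : a \in P -> (op a @: U <= grow U)%VS.
Proof.
by move=> Pa; apply: subv_trans (addvSr _ _); apply: (sumv_sup a).
Qed.

(** The dimension rises at each step before the first escape from K: a step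
    that leaves the dimension unchanged would make the chain stationary inside
    K. *)
Lemma chain_escape U K k : ~~ (iter k grow U <= K)%VS ->
  exists2 l, ~~ (iter l grow U <= K)%VS &
    forall i, (i < l)%N ->
      (iter i grow U <= K)%VS /\ (\dim U + i <= \dim (iter i grow U))%N.
Proof.
move=> escK; have exK : exists j, ~~ (iter j grow U <= K)%VS by exists k.
case: (ex_minnP exK) => l escl minl; exists l => // i.
have below j : (j < l)%N -> (iter j grow U <= K)%VS.
  by apply: contraTT => /minl; rewrite -leqNgt.
elim: i => [|i IHi] lt_il; first by rewrite addn0 below.
have [_ le_dim] := IHi (ltnW lt_il); split; first exact: below.
rewrite addnS; apply: leq_ltn_trans le_dim _.
rewrite ltn_neqAle dimvS ?sub_grow // andbT.
apply: contraNN escl => eq_dim.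
have fix_i : grow (iter i grow U) = iter i grow U.
  by apply/esym/eqP; rewrite -(dimv_leqif_eq (sub_grow _)).
rewrite -(subnK (ltnW (ltnW lt_il))) iterD.
by elim: (l - i)%N => [|j IHj]; rewrite ?below ?(ltnW lt_il) // iterSr fix_i.
Qed.

End SubspaceChains.

(** * The action of words on rational functions *)

Section Pullback.

Local Open Scope ring_scope.

Variable X : finType.
Implicit Types (h : X -> X) (f : {ffun X -> rat^o}) (w : seq (transf X)).
Implicit Types (Sigma : {set transf X}) (S : {set X}).

Definition precomp h f : {ffun X -> rat^o} := [ffun x => f (h x)].

Fact precomp_is_linear h : linear (precomp h).
Proof. by move=> c f1 f2; apply/ffunP=> x; rewrite !ffunE. Qed.

HB.instance Definition _ h :=
  GRing.isLinear.Build rat _ _ _ (precomp h) (precomp_is_linear h).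

Definition pull h : 'End({ffun X -> rat^o}) := linfun (precomp h).

Lemma pullE h f x : pull h f x = f (h x).
Proof. by rewrite lfunE ffunE. Qed.

Definition act w := pull (@run X ^~ w).

Lemma run_cat x w1 w2 : run x (w1 ++ w2) = run (run x w1) w2.
Proof. exact: foldl_cat. Qed.

Lemma act_cat w1 w2 f : act (w1 ++ w2) f = act w1 (act w2 f).
Proof. by apply/ffunP=> x; rewrite !pullE run_cat. Qed.

Lemma act_nil f : act [::] f = f.
Proof. by apply/ffunP=> x; rewrite pullE. Qed.

Definition sum_values f : rat^o := \sum_x f x.

Fact sum_values_is_linear : linear sum_values.
Proof.
move=> c f1 f2; rewrite /sum_values scaler_sumr -big_split.
by apply: eq_bigr => x _; rewrite !ffunE.
Qed.

HB.instance Definition _ :=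
  GRing.isLinear.Build rat _ _ _ sum_values sum_values_is_linear.

Definition total : 'Hom({ffun X -> rat^o}, rat^o) := linfun sum_values.

Lemma totalE f : total f = \sum_x f x.
Proof. by rewrite lfunE. Qed.

Lemma dim_functions : \dim {:{ffun X -> rat^o}} = #|X|.
Proof. by rewrite dimvf /dim /= muln1. Qed.

Lemma dim_lker_total : (0 < #|X|)%N -> \dim (lker total) = #|X|.-1.
Proof.
case/card_gt0P=> x0 _; have := limg_ker_dim total fullv.
rewrite capfv dim_functions; suff -> : \dim (total @: fullv) = 1%N.
  by rewrite addn1 => <-.
apply/eqP; rewrite eqn_leq; apply/andP; split.
  by rewrite (leq_trans (dimvS (subvf _))) // dimvf.
rewrite lt0n dimv_eq0 -lkerE; apply/subvPn.
exists [ffun x => (x == x0)%:R : rat^o]; first exact: memvf.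
rewrite memv_ker totalE (bigD1 x0) //= ffunE eqxx big1 ?addr0 ?oner_eq0 //.
by move=> x /negPf nx; rewrite ffunE nx.
Qed.

Definition letter_act (a : transf X) := pull a.

(** Together with [iter_grow_sub], this identifies the l-th term of the chain
    generated by U with the span of the functions w f, for f in U and words w
    of length at most l. *)
Lemma act_iter_grow Sigma w U : word_over Sigma w ->
  (act w @: U <= iter (size w) (grow letter_act Sigma) U)%VS.
Proof.
elim: w => [|a w IHw] Sw /=.
  by apply/subvP=> _ /memv_imgP[f Uf ->]; rewrite act_nil.
have Sa : a \in Sigma by apply: Sw; rewrite mem_head.
have Sw' : word_over Sigma w by move=> b wb; apply: Sw; rewrite inE wb orbT.
apply: subv_trans (img_sub_grow letter_act _ Sa).
apply/subvP=> _ /memv_imgP[f Uf ->]; rewrite (act_cat [:: a] w).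
by apply: memv_img; apply: (subvP (IHw Sw')); apply: memv_img.
Qed.

Lemma iter_grow_sub Sigma l (U K : {vspace {ffun X -> rat^o}}) :
    (forall w f, word_over Sigma w -> (size w <= l)%N -> f \in U ->
       act w f \in K) ->
  (iter l (grow letter_act Sigma) U <= K)%VS.
Proof.
elim: l U => [|l IHl] U wK.
  by apply/subvP=> f Uf; rewrite -(act_nil f); apply: wK.
rewrite iterSr; apply: IHl => w f Sw le_wl.
case/memv_addP=> f1 Uf1 [f2 + ->]; rewrite linearD /= => Uf2.
apply: memvD; first by apply: wK; rewrite ?(leqW le_wl).
case/memv_sumP: Uf2 => g Ug ->; rewrite linear_sum; apply: memv_suml => a Sa.
have /memv_imgP[f3 Uf3 ->] := Ug a Sa.
suff : act (rcons w a) f3 \in K by rewrite -cats1 act_cat.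
apply: wK; rewrite ?size_rcons // => b; rewrite mem_rcons inE.
by case/predU1P=> [->|/Sw].
Qed.

Lemma iter_grow_escape Sigma l (U K : {vspace {ffun X -> rat^o}}) :
    ~~ (iter l (grow letter_act Sigma) U <= K)%VS ->
  exists w, exists2 f, f \in U &
    [/\ word_over Sigma w, (size w <= l)%N & act w f \notin K].
Proof.
move=> escK; apply: contrapT => noW; case/negP: escK.
apply: iter_grow_sub => w f Sw le_wl Uf; apply: contrapT => /negP Kwf.
by apply: noW; exists w, f.
Qed.

Definition centered S : {ffun X -> rat^o} :=
  [ffun x => (x \in S)%:R - #|S|%:R / #|X|%:R].

Definition word_preim S w : {set X} := [set x | run x w \in S].

(** Turns the comparison of cardinals in the extension property into the sign
    of a linear form. *)
Lemma total_act_centered S w : (0 < #|X|)%N ->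
  total (act w (centered S)) = #|word_preim S w|%:R - #|S|%:R :> rat.
Proof.
move=> X_gt0; rewrite totalE.
under eq_bigr do rewrite pullE ffunE.
rewrite big_split /= sumrN sumr_const -[X in - X]mulr_natr divfK.
  congr (_ - _); rewrite -sum1_card natr_sum [RHS]big_mkcond /=.
  by apply: eq_bigr => x _; rewrite inE; case: ifP.
by rewrite pnatr_eq0 -lt0n.
Qed.

Lemma word_preim_nil S : word_preim S [::] = S.
Proof. by apply/setP=> x; rewrite inE. Qed.

Lemma centered_neq0 S : (0 < #|S| < #|X|)%N -> centered S != 0.
Proof.
case/andP=> S_gt0 S_ltX; apply/eqP=> /ffunP S0.
have [x Sx] := card_gt0P S_gt0.
have /subsetPn[y _ S'y] : ~~ ([set: X] \subset S).
  by apply: contraL S_ltX => /subset_leq_card; rewrite cardsT -leqNgt.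
have : centered S x = centered S y by rewrite S0 S0 !ffunE.
by rewrite !ffunE Sx (negPf S'y) => /addIr/eqP; rewrite oner_eq0.
Qed.

End Pullback.

Arguments total {X}.
Arguments letter_act {X}.

(** * From extending subsets to synchronizing words *)

Section Extension.

Variable X : finType.
Variable Sigma : {set transf X}.
Implicit Types (S : {set X}) (w v : seq (transf X)).

Lemma word_over_cat (T : finType) (A : {set T}) (w v : seq T) :
  word_over A w -> word_over A v -> word_over A (w ++ v).
Proof. by move=> Aw Av a; rewrite mem_cat => /orP[/Aw|/Av]. Qed.

Lemma word_preim_cat S w v :
  word_preim S (v ++ w) = word_preim (word_preim S w) v.
Proof. by apply/setP=> x; rewrite !inE run_cat. Qed.

Lemma iterate_extension L S :
    (forall S, 0 < #|S| < #|X| -> exists2 v, word_over Sigma v &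
        size v <= L /\ #|S| < #|word_preim S v|) ->
    0 < #|S| -> exists2 v, word_over Sigma v &
      size v <= L * (#|X| - #|S|) /\ word_preim S v = [set: X].
Proof.
move=> ext; have [k] := ubnP (#|X| - #|S|).
elim: k S => // k IHk S lt_k S_gt0.
have [S_lt|S_ge] := ltnP #|S| #|X|; last first.
  exists [::] => //; rewrite word_preim_nil; split=> //.
  by apply/eqP; rewrite eqEcard subsetT cardsT.
have [|v Sv [sz_v lt_Sv]] := ext S; first by rewrite S_gt0.
have [||u Su [sz_u preim_u]] := IHk (word_preim S v); [lia | lia |].
exists (u ++ v); first exact: word_over_cat.
rewrite size_cat word_preim_cat; split=> //.
apply: leq_trans (leq_add sz_u sz_v) _.
by rewrite -mulnSr leq_mul2l; apply/orP; right; lia.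
Qed.

Lemma noninjective_letter : 1 < #|X| -> synchronizing Sigma ->
  exists2 a : transf X, a \in Sigma & ~ injective a.
Proof.
move=> X_gt1 [w [Sw /eqP/cards1P[y im_w]]]; apply: contrapT => inj.
have run_inj : injective (@run X ^~ w).
  elim: w Sw {im_w} => [|a w IHw] Sw; first by move=> x z.
  move=> x z /= /IHw eq_a; apply: contrapT => ne_xz; apply: inj.
  exists a; first by apply: Sw; rewrite mem_head.
  move=> inj_a; apply: ne_xz; apply: inj_a; apply: eq_a.
  by move=> b wb; apply: Sw; rewrite inE wb orbT.
have := card_imset [set: X] run_inj; rewrite cardsT.
suff -> : [set run x w | x in [set: X]] = [set y].
  by rewrite cards1 => eqX; rewrite -eqX in X_gt1.
by rewrite -im_w; apply/setP=> x; apply/imsetP/imsetP => -[z _ ->]; exists z.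
Qed.

(** The last letter of the word collapses a fibre S with at least two elements
    to a point, and the rest of the word sends every state into S: each
    extension gains at least one element, so n - 2 extensions suffice. *)
Lemma sync_word_of_extension L : 1 < #|X| -> synchronizing Sigma ->
    (forall S, 0 < #|S| < #|X| -> exists2 v, word_over Sigma v &
        size v <= L /\ #|S| < #|word_preim S v|) ->
  has_sync_word_leq Sigma (1 + L * (#|X| - 2)).
Proof.
move=> X_gt1 syncS ext; have [a Sa a_ninj] := noninjective_letter X_gt1 syncS.
have [x1 [x2 [ne_x eq_a]]] : exists x1 x2, x1 != x2 /\ a x1 = a x2.
  apply: contrapT => no_x; apply: a_ninj => x1 x2 eq_a.
  by apply: contrapT => /eqP ne_x; apply: no_x; exists x1, x2.
pose S := [set x | a x == a x1].
have S_ge2 : 2 <= #|S|.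
  rewrite -(_ : #|[set x1; x2]| = 2); last by rewrite cards2 ne_x.
  by apply/subset_leq_card/subsetP=> x /set2P[]->; rewrite inE ?eq_a.
have [|v Sv [sz_v preim_v]] := iterate_extension (S := S) ext; first lia.
exists (rcons v a); last first.
  rewrite size_rcons add1n ltnS (leq_trans sz_v) // leq_mul2l.
  by apply/orP; right; lia.
split; first by rewrite -cats1; apply: word_over_cat => // b /[!inE]/eqP->.
apply/eqP/cards1P; exists (a x1); apply/setP=> y; rewrite inE.
have run_va x : run x (rcons v a) = a x1.
  by have /[!inE]/eqP : x \in word_preim S v; rewrite ?preim_v ?inE //
    -cats1 run_cat.
apply/imsetP/eqP=> [[x _ ->] // | ->]; by exists x1.
Qed.

End Extension.

(** * Rational functions on a group *)

Section GroupFunctions.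

Local Open Scope ring_scope.

Variable gT : finGroupType.
Implicit Types (g h : gT) (f : {ffun gT -> rat^o}) (w : seq (transf gT)).
Implicit Types U K : {vspace {ffun gT -> rat^o}}.

Definition shift g := pull (fun x : gT => (x * g)%g).

Lemma shift1 f : shift 1%g f = f.
Proof. by apply/ffunP=> x; rewrite pullE mulg1. Qed.

Lemma total_shift g f : total (shift g f) = total f.
Proof.
rewrite !totalE (reindex_inj (mulIg g^-1%g)).
by apply: eq_bigr => x _; rewrite pullE mulgKV.
Qed.

Lemma sum_total_act_shift w f :
  \sum_g total (act w (shift g f)) = total f *+ #|gT|.
Proof.
under eq_bigr do rewrite totalE.
rewrite exchange_big /= -sumr_const; apply: eq_bigr => x _.
rewrite totalE (reindex_inj (mulgI (run x w)^-1%g)).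
by apply: eq_bigr => g _; rewrite !pullE mulKVg.
Qed.

(** The averaging argument: the sum over all g vanishes, so a nonzero term
    forces a positive one. *)
Lemma exists_shift_gt0 w h f : total f = 0 -> total (act w (shift h f)) != 0 ->
  exists g, 0 < (total (act w (shift g f)) : rat).
Proof.
move=> f0 nz; apply: contrapT => no_g; case/negP: nz.
have le0 g : (total (act w (shift g f)) : rat) <= 0.
  by rewrite leNgt; apply/negP=> gt0; apply: no_g; exists g.
have sum0 : \sum_g - (total (act w (shift g f)) : rat) = 0.
  by rewrite sumrN sum_total_act_shift f0 mul0rn oppr0.
rewrite -oppr_eq0; apply/eqP.
have ge0 g : true -> 0 <= - (total (act w (shift g f)) : rat).
  by rewrite oppr_ge0.
exact: (psumr_eq0P ge0 sum0).
Qed.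

Definition orbit_span U : {vspace {ffun gT -> rat^o}} :=
  (\sum_g shift g @: U)%VS.

Lemma mem_orbit_span g f U : f \in U -> shift g f \in orbit_span U.
Proof.
by move=> Uf; apply: (subvP (sumv_sup g isT (subvv _))); apply: memv_img.
Qed.

Lemma orbit_span_subP U (K : {vspace {ffun gT -> rat^o}}) :
  (forall g f, f \in U -> shift g f \in K) -> (orbit_span U <= K)%VS.
Proof.
move=> UK; apply/subv_sumP=> g _; apply/subvP=> _ /memv_imgP[f Uf ->].
exact: UK.
Qed.

Lemma sub_orbit_span U : (U <= orbit_span U)%VS.
Proof. by apply/subvP=> f Uf; rewrite -[f]shift1 mem_orbit_span. Qed.

Section RepresentationMap.

Variables (d : nat) (rG : mx_representation rat [set: gT] d) (u : 'rV[rat]_d).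

(** Under the identification of functions with elements of the group algebra,
    this is the morphism from the regular module to the module of rG that sends
    1 to u; it intertwines [shift g] with the action of g^-1. *)
Definition coef_sum f : 'rV[rat]_d := \sum_x (f x : rat) *: (u *m rG x).

Fact coef_sum_is_linear : linear coef_sum.
Proof.
move=> c f1 f2; rewrite /coef_sum scaler_sumr -big_split.
by apply: eq_bigr => x _; rewrite !ffunE scalerDl scalerA.
Qed.

HB.instance Definition _ :=
  GRing.isLinear.Build rat _ _ _ coef_sum coef_sum_is_linear.

Definition repr_map : 'Hom({ffun gT -> rat^o}, 'rV[rat]_d) := linfun coef_sum.

Lemma repr_mapE f : repr_map f = \sum_x (f x : rat) *: (u *m rG x).
Proof. by rewrite lfunE. Qed.

Lemma repr_map_shift g f : repr_map (shift g f) = repr_map f *m rG g^-1%g.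
Proof.
rewrite !repr_mapE (reindex_inj (mulIg g^-1%g)) mulmx_suml.
apply: eq_bigr => x _; rewrite pullE mulgKV -scalemxAl -mulmxA.
by rewrite repr_mxM ?inE.
Qed.

Hypothesis irrG : mx_irreducible rG.

(** The image contains the G-orbit of a nonzero vector, and in an irreducible
    module such an orbit spans everything. *)
Lemma img_repr_map_full f (U : {vspace {ffun gT -> rat^o}}) :
  repr_map f != 0 -> (forall g, shift g f \in U) ->
  (repr_map @: U)%VS = fullv.
Proof.
move=> nz_f Uf; apply/eqP; rewrite eqEsubv subvf; apply/subvP=> v _.
have /cyclic_mxP[_ /envelop_mxP[a ->] ->] : (v <= cyclic_mx rG (repr_map f))%MS.
  by rewrite -(mxsimple_cyclic irrG nz_f (submx1 _)) submx1.
rewrite mulmx_sumr; apply: memv_suml => g _.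
rewrite -scalemxAr; apply: memvZ; rewrite -[g]invgK -repr_map_shift.
exact: memv_img.
Qed.

Lemma dim_rowvectors : \dim {:'rV[rat]_d} = d.
Proof. by rewrite dimvf /dim /= mul1n. Qed.

Lemma repr_map_delta1 : repr_map [ffun x => (x == 1%g)%:R] = u.
Proof.
rewrite repr_mapE (bigD1 1%g) //= ffunE eqxx scale1r repr_mx1 mulmx1.
by rewrite big1 ?addr0 // => x /negPf nx; rewrite ffunE nx scale0r.
Qed.

Lemma dim_lker_repr_map : u != 0 -> (\dim (lker repr_map) + d)%N = #|gT|.
Proof.
move=> nz_u; rewrite -dim_functions -(limg_ker_dim repr_map fullv) capfv.
rewrite (@img_repr_map_full [ffun x => (x == 1%g)%:R]) ?dim_rowvectors //.
  by rewrite repr_map_delta1.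
by move=> g; apply: memvf.
Qed.

(** One vector of U outside the kernel contributes a whole copy of the
    irreducible module to the generated submodule, independently of W. *)
Lemma dim_orbit_span_gt (W U : {vspace {ffun gT -> rat^o}}) :
    (W <= lker repr_map)%VS -> (W <= U)%VS -> ~~ (U <= lker repr_map)%VS ->
  (\dim W + d <= \dim (orbit_span U))%N.
Proof.
move=> kerW sWU /subvPn[f Uf]; rewrite memv_ker => nz_f.
rewrite -(limg_ker_dim repr_map (orbit_span U)).
rewrite (img_repr_map_full nz_f) => [|g]; last exact: mem_orbit_span.
rewrite dim_rowvectors leq_add2r dimvS // subv_cap kerW andbT.
exact: subv_trans sWU (sub_orbit_span _).
Qed.

End RepresentationMap.

End GroupFunctions.

(** * Automata containing a Cayley graph *)

Section CayleyAutomata.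

Local Open Scope ring_scope.

Variables (gT : finGroupType) (Delta : {set gT}) (Sigma : {set transf gT}).
Variable m : nat.
Implicit Types (f : {ffun gT -> rat^o}) (U : {vspace {ffun gT -> rat^o}}).
Hypothesis sDS : cayley Delta \subset Sigma.
Hypothesis coverD : covers Delta m.
Hypothesis syncS : synchronizing Sigma.

Lemma run_right_transl (x : gT) (w : seq gT) :
  run x (map (@right_transl gT) w) = (x * \prod_(d <- w) d)%g.
Proof.
elim: w x => [|d w IHw] x; first by rewrite big_nil mulg1.
by rewrite big_cons /= IHw ffunE mulgA.
Qed.

Lemma shift_word g : exists v, [/\ word_over Sigma v, (size v <= m)%N &
  forall f, act v f = shift g f].
Proof.
have [w [Dw sz_w prod_w]] := coverD g; exists (map (@right_transl gT) w).
split; first by move=> _ /mapP[d wd ->]; apply/(subsetP sDS)/imset_f/Dw.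
  by rewrite size_map.
by move=> f; apply/ffunP=> x; rewrite !pullE run_right_transl prod_w.
Qed.

(** A synchronizing word turns f into the constant function with value f c,
    where c is its only end state; precomposing f with a translation first
    makes that value any prescribed value of f, so a nonzero one. *)
Lemma escape_total f U : f \in U -> f != 0 ->
  exists k, ~~ (iter k (grow letter_act Sigma) U <= lker total)%VS.
Proof.
move=> Uf nz_f; have [w [Sw /eqP/cards1P[c im_w]]] := syncS.
have [y nz_y] : exists y, f y != 0.
  apply: contrapT => no_y; case/eqP: nz_f; apply/ffunP=> y; rewrite ffunE.
  by apply: contrapT => /eqP nz_y; apply: no_y; exists y.
have [v [Sv _ act_v]] := shift_word (c^-1 * y)%g.
exists (size (w ++ v)); apply/subvPn; exists (act (w ++ v) f).
  by apply: (subvP (act_iter_grow _ (word_over_cat Sw Sv))); apply: memv_img.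
rewrite memv_ker totalE (eq_bigr (fun=> f y)) => [|x _].
  rewrite sumr_const -mulr_natr mulf_neq0 // pnatr_eq0 -lt0n.
  by apply/card_gt0P; exists y.
have /set1P run_x : run x w \in [set c] by rewrite -im_w; apply/imsetP; exists x.
by rewrite act_cat act_v !pullE run_x mulKVg.
Qed.

Lemma averaged_word w1 w2 h f :
    word_over Sigma w1 -> word_over Sigma w2 -> total (act w2 f) = 0 ->
    total (act w1 (shift h (act w2 f))) != 0 ->
  exists2 v, word_over Sigma v &
    (size v <= size w1 + m + size w2)%N /\ 0 < (total (act v f) : rat).
Proof.
move=> Sw1 Sw2 tot0 nz; have [g gt0] := exists_shift_gt0 tot0 nz.
have [u [Su sz_u act_u]] := shift_word g; exists (w1 ++ u ++ w2).
  by do 2?[apply: word_over_cat => //].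
by rewrite !act_cat act_u; split=> //; rewrite !size_cat addnA leq_add2r leq_add2l.
Qed.

(** The two cases are those of the dimension count: the chain of f first leaves
    ker phi :&: ker total either through ker total or only through ker phi. *)
Lemma positive_word d f : Defs.irr_degree [set: gT]%G d -> f != 0 -> total f = 0 ->
  exists2 v, word_over Sigma v &
    (size v <= #|gT| - d + m)%N /\ 0 < (total (act v f) : rat).
Proof.
move=> [rG irrG] nz_f tot_f.
have [d_gt0 _] := (iffLR (mx_irrP rG)) irrG.
pose u : 'rV[rat]_d := delta_mx ord0 (Ordinal d_gt0).
have nz_u : u != 0.
  apply/eqP => /matrixP/(_ ord0 (Ordinal d_gt0))/eqP.
  by rewrite !mxE !eqxx oner_eq0.
have gT_gt0 : (0 < #|gT|)%N by apply/card_gt0P; exists 1%g.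
have dim_ker_repr := dim_lker_repr_map irrG nz_u.
pose phi := repr_map rG u; pose F j := iter j (grow letter_act Sigma) <[f]>%VS.
have [k esc_k] := escape_total (memv_line f) nz_f.
have esc_cap : ~~ (F k <= lker phi :&: lker total)%VS.
  by apply: contra esc_k => /subv_trans; apply; apply: capvSr.
have {k esc_k esc_cap} [j esc_j below_j] := chain_escape esc_cap.
have dim_below i : (i < j)%N -> (i < \dim (F i))%N.
  by case/below_j=> _; rewrite dim_vline nz_f.
have [tot_j | esc_tot] := boolP (F j <= lker total)%VS; last first.
  (* Leaving ker total: a word w with at most \dim (ker phi) letters has
     total (act w f) != 0, and the average runs over the last factor. *)
  have [w [g /vlineP[c ->] [Sw sz_w]]] := iter_grow_escape esc_tot.
  rewrite memv_ker linearZ /= linearZ /= => nz_w.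
  have tot_nil : total (act [::] f) = 0 by rewrite act_nil.
  have Snil : word_over Sigma [::] by [].
  have [|v Sv [sz_v gt0]] := averaged_word (h := 1%g) Sw Snil tot_nil.
    by rewrite act_nil shift1; apply: contraNneq nz_w => ->; rewrite scaler0.
  exists v => //; split=> //; apply: leq_trans sz_v _.
  rewrite addn0 leq_add2r -dim_ker_repr addnK (leq_trans sz_w) //.
  case: j {esc_tot sz_w} esc_j below_j dim_below => // j _ below_j dim_below.
  apply: leq_trans (dim_below j (leqnn _)) (dimvS _).
  by have [/subv_trans-> //] := below_j j (leqnn _); apply: capvSl.
(* Leaving ker phi only: pass to the submodule M generated by F j, whose
   dimension makes up both for the j letters used and for the degree d. *)
have {esc_j} esc_phi : ~~ (F j <= lker phi)%VS.
  by rewrite subv_cap tot_j andbT in esc_j.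
pose M := orbit_span (F j).
have dim_M : (j + d <= \dim M)%N.
  case: j @M esc_phi below_j dim_below {tot_j} => [|j] M esc_phi below_j dim_below.
    have := dim_orbit_span_gt irrG (sub0v _) (sub0v _) esc_phi.
    by rewrite dimv0.
  have [sub_j _] := below_j j (leqnn _).
  apply: leq_trans (dim_orbit_span_gt irrG (W := F j) _ _ esc_phi).
  - by rewrite leq_add2r dim_below.
  - by apply: subv_trans sub_j (capvSl _ _).
  exact: sub_grow.
have M_tot : (M <= lker total)%VS.
  apply: orbit_span_subP => g f1 Ff1.
  by rewrite memv_ker total_shift -memv_ker (subvP tot_j).
have Mf : f \in M.
  apply: (subvP (sub_orbit_span _)).
  exact: subvP (iter_grow_mono _ _ _ (leq0n j)) _ (memv_line f).
have [k esc_k] := escape_total Mf nz_f.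
have {k esc_k} [l esc_l below_l] := chain_escape esc_k.
have le_l : (l + \dim M <= #|gT|)%N.
  case: l esc_l below_l => [|l] esc_l below_l; first by rewrite M_tot in esc_l.
  have [tot_l le_dim] := below_l l (leqnn _).
  have := leq_trans le_dim (dimvS tot_l); rewrite dim_lker_total //.
  by rewrite -ltnS prednK // addnC.
have [w1 [f1 Mf1 [Sw1 sz_w1 nz_w1]]] := iter_grow_escape esc_l.
(* An element of M on which w1 has nonzero total is a combination of translates
   by h of functions act w2 f, so it may be taken to be one of them. *)
have [h esc_h] : exists h, ~~ (F j <= lker (total \o act w1 \o shift h))%VS.
  apply: contrapT => no_h; case/negP: nz_w1.
  suff: (M <= lker (total \o act w1))%VS.
    by move/subvP/(_ _ Mf1); rewrite !memv_ker comp_lfunE.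
  apply: orbit_span_subP => h f2 Ff2.
  have : f2 \in lker (total \o act w1 \o shift h).
    by apply: contrapT => /negP nz; apply: no_h; exists h; apply/subvPn; exists f2.
  by rewrite !memv_ker comp_lfunE.
have [w2 [_ /vlineP[c ->] [Sw2 sz_w2]]] := iter_grow_escape esc_h.
rewrite memv_ker !comp_lfunE !linearZ /= => nz_w2.
have tot_w2 : total (act w2 f) = 0.
  apply/eqP; rewrite -memv_ker; apply: (subvP tot_j).
  apply: subvP (iter_grow_mono _ _ _ sz_w2) _ _.
  by apply: (subvP (act_iter_grow _ Sw2)); apply: memv_img (memv_line f).
have [|v Sv [sz_v gt0]] := averaged_word (h := h) Sw1 Sw2 tot_w2.
  by apply: contraNneq nz_w2 => ->; rewrite scaler0.
exists v => //; split=> //; apply: leq_trans sz_v _.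
have le_n : (l + (j + d) <= #|gT|)%N by rewrite (leq_trans _ le_l) ?leq_add2l.
have arith n a b : (a <= l -> b <= j -> l + (j + d) <= n ->
  a + m + b <= n - d + m)%N by lia.
exact: arith sz_w1 sz_w2 le_n.
Qed.

End CayleyAutomata.

Lemma diam_covers (gT : finGroupType) (Delta : {set gT})
  (genD : <<Delta>>%g = [set: gT]) : covers Delta (diam genD).
Proof. by rewrite /diam; case: ex_minnP => m /andP[_ /asboolP]. Qed.

Lemma max_irr_degreeP (gT : finGroupType) (G : {group gT}) :
  Defs.irr_degree G (max_irr_degree G).
Proof. by rewrite /max_irr_degree; case: ex_maxnP => d /asboolP. Qed.

Lemma max_irr_degree_leq (gT : finGroupType) (G : {group gT}) :
  max_irr_degree G <= #|G|.
Proof. exact/irr_degree_leq/asboolP/max_irr_degreeP. Qed.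

Theorem theorem3p4 (gT : finGroupType) (Delta : {set gT})
    (Sigma : {set transf gT})
    (n_gt1 : (1 < #|gT|)%N)
    (genD : <<Delta>>%g = [set: gT])
    (sDS : cayley Delta \subset Sigma)
    (syncS : synchronizing Sigma) :
  has_sync_word_leq Sigma
    (1 + (#|gT| - max_irr_degree [set: gT]%G + diam genD) * (#|gT| - 2))%N /\
  ((diam genD <= max_irr_degree [set: gT]%G)%N ->
     has_sync_word_leq Sigma ((#|gT| - 1) ^ 2)%N /\ cerny_cayley Delta).
Proof.
have bound (T : {set transf gT}) : cayley Delta \subset T -> synchronizing T ->
    has_sync_word_leq T
      (1 + (#|gT| - max_irr_degree [set: gT]%G + diam genD) * (#|gT| - 2)).
  move=> sDT syncT; apply: sync_word_of_extension => // S S_proper.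
  have gT_gt0 := ltnW n_gt1.
  have tot0 : total (centered S) = 0%R.
    by rewrite -(act_nil (centered S)) total_act_centered // word_preim_nil subrr.
  have [v Tv [sz_v]] := positive_word sDT (diam_covers genD) syncT
    (max_irr_degreeP _) (centered_neq0 S_proper) tot0.
  by rewrite total_act_centered // subr_gt0 ltr_nat; exists v.
split=> [|diam_le]; first exact: bound.
have cerny : cerny_cayley Delta.
  move=> T sDT syncT; have [w sync_w le_w] := bound T sDT syncT.
  exists w => //; apply: leq_trans le_w _.
  have := max_irr_degree_leq [set: gT]%G; rewrite cardsT.
  have arith n m k : 1 < n -> k <= m -> m <= n ->
    1 + (n - m + k) * (n - 2) <= (n - 1) ^ 2 by nia.
  exact: arith n_gt1 diam_le.
by split=> //; apply: cerny.
Qed.
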